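(* Let $\{m_{\underline\theta}:\underline\theta\in\underline\Theta\}$ be a regular family with a $k$-dimensional interest parameter $\theta$ and $k'$-dimensional nuisance parameter $\tilde\theta$ (as described in the context), let $s=(\nabla\ell)^\perp$ be the orthogonalized score, let $I^\perp=\mathsf{V}(s)$ be the orthogonalized Fisher information for $\theta$, and let $\mathcal{G}$ be the space of generalized estimators for $\theta$. For any $g\in\mathcal{G}$, $$\Lambda(g)\le I^\perp$$ (in the positive semidefinite order, at every $\underline\theta\in\underline\Theta$), and $s$ attains this bound: $\Lambda(s)=I^\perp$. Furthermore, for any $g\in\mathcal{G}$, $$\Lambda(g)=\mathsf{V}(\mathsf{P}_g s)=\mathsf{V}(\mathsf{P}_g\nabla\ell)=(I^\perp)^{1/2}\,\mathsf{R}\,\mathsf{R}^{t}\,(I^\perp)^{1/2},$$ where $\mathsf{R}=\mathsf{E}(\bar s\,\bar g^{t})$ is the correlation matrix between $s$ and $g$.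
   Context: Family. $\mathcal{Y}$ is a sample space with dominating measure $\mu$ (counting measure when $\mathcal{Y}$ is discrete). $M$ is a family of probability densities $m>0$ on $\mathcal{Y}$ with respect to $\mu$ (common support) which is a smooth manifold of dimension $k+k'$, $k\ge1$, $k'\ge0$, with a global parameterization (diffeomorphism) $\underline\theta:M\to\underline\Theta\subset\mathbb{R}^{k+k'}$, $\underline\Theta$ open, $\underline\theta^t=(\theta^t,\tilde\theta^t)$, where $\theta\in\mathbb{R}^k$ is the interest parameter and $\tilde\theta\in\mathbb{R}^{k'}$ the nuisance parameter. Write $m_{\underline\theta}$ for the corresponding member of $M$ and $E_{\underline\theta}h=\int_{\mathcal{Y}}h\,m_{\underline\theta}\,d\mu$. $\nabla$ and $\tilde\nabla$ denote the column gradients with respect to $\theta$ and $\tilde\theta$. For an $\mathbb{R}^k$-valued $f$, $\nabla f^t$ is the $k\times k$ matrix with $(a,b)$ entry $\partial f_b/\partial\theta^a$. For $f$ on $\mathcal{Y}\times\underline\Theta$, $\mathsf{E}f$ denotes the function $\underline\theta\mapsto E_{\underline\theta}f(\cdot,\underline\theta)$. Scores. $\ell(y,\underline\theta)=\log m_{\underline\theta}(y)$; $\nabla\ell$ is the score for $\theta$ and $\tilde s=\tilde\nabla\ell$ the score for $\tilde\theta$. Hilbert spaces. $H_M=\{h:\mathcal{Y}\to\mathbb{R}\text{ measurable}:E_mh^2<\infty\ \forall m\in M\}$ with inner products $\langle h,h'\rangle_{\underline\theta}=E_{\underline\theta}(hh')$. $\tilde T_{\underline\theta}M$ is the span of the components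 of $\tilde s(\cdot,\underline\theta)$ ($\{0\}$ if $k'=0$). $H^\perp_{\underline\theta}=\{h\in H_M:E_{\underline\theta}h=0,\ h\perp_{\underline\theta}\tilde T_{\underline\theta}M\}$. An $\mathbb{R}^k$-valued function is said to lie in $H_M$ or $H^\perp_{\underline\theta}$ if each component does. Generalized estimators. A generalized estimator for $\theta$ is $g:\mathcal{Y}\times\underline\Theta\to\mathbb{R}^k$ such that (I) $g(y,\cdot)\in C^1(\underline\Theta,\mathbb{R}^k)$ for a.e. $y$; (II) $g(\cdot,\underline\theta)\in H^\perp_{\underline\theta}$ for all $\underline\theta$; (III) $\mathsf{V}(g)$ is positive definite on $\underline\Theta$, where $\mathsf{V}(g)=\mathsf{E}(gg^t)\in C^1(\underline\Theta,\mathbb{R}^{k\times k})$. The set of these is $\mathcal{G}$. Orthogonalization. For $f$ with $f(\cdot,\underline\theta)\in H_M$ for all $\underline\theta$, $f^\perp=f-\mathsf{E}f-\tilde{\mathsf{P}}f$, where $\tilde{\mathsf{P}}$ is, at each $\underline\theta$, the componentwise orthogonal projection onto $\tilde T_{\underline\theta}M$. The orthogonalized score is $s=(\nabla\ell)^\perp$ and $I^\perp=\mathsf{V}(s)$. Standing assumptions. The components of $\nabla\ell$ and $\tilde s$ are in $H_M$ for every $\underline\theta$ and have $\mathsf{E}$ equal to $0$, and $s\in\mathcal{G}$ (so $I^\perp$ is positive definite). Differentiation commutes with integration: for every $f:\mathcal{Y}\times\underline\Theta\to\mathbb{R}^k$ satisfying (I) and (III) with $f(\cdot,\underline\theta)\in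 H_M$ for all $\underline\theta$ (in particular every $f\in\mathcal{G}$), the expectations exist and $\nabla\mathsf{E}(f^t)=\mathsf{E}(\nabla f^t)+\mathsf{E}((\nabla\ell)f^t)$, and likewise with $\tilde\nabla$ in place of $\nabla$. Standardization and information. $\bar g=\mathsf{V}(g)^{-1/2}g$ and $\bar s=\mathsf{V}(s)^{-1/2}s$ (symmetric positive definite square roots). The information for $\theta$ utilized by $g$ is $$\Lambda(g)=(\mathsf{E}\nabla\bar g^t)(\mathsf{E}\nabla\bar g^t)^t=(\mathsf{E}\nabla g^t)\,\mathsf{V}^{-1}(g)\,(\mathsf{E}\nabla g^t)^t.$$ Projection. For an $\mathbb{R}^k$-valued $f$, $\mathsf{P}_g f$ is, at each $\underline\theta$, the componentwise orthogonal projection (with respect to $\langle\cdot,\cdot\rangle_{\underline\theta}$) of $f(\cdot,\underline\theta)$ onto the span of the components of $g(\cdot,\underline\theta)$, and $\mathsf{V}(\mathsf{P}_gf)=\mathsf{E}((\mathsf{P}_gf)(\mathsf{P}_gf)^t)$. For symmetric matrices, $A\le B$ means $B-A$ is positive semidefinite. *)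

(* Defs.v *)
(* MathComp-Analysis *)
From HB Require Import structures.
From mathcomp Require Import all_boot all_order all_algebra.
From mathcomp Require Import all_classical all_reals all_analysis.

Set Implicit Arguments.
Unset Strict Implicit.
Unset Printing Implicit Defensive.

Import Order.TTheory GRing.Theory Num.Theory.
Import numFieldNormedType.Exports.

Local Open Scope classical_set_scope.
Local Open Scope ring_scope.

Section Matrices.
Variables (R : realType) (n : nat).
Implicit Types A B : 'M[R]_n.

Definition psdmx A :=
  A^T = A /\ forall x : 'cV[R]_n, 0 <= (x^T *m A *m x) 0 0.

Definition posdefmx A :=
  A^T = A /\ forall x : 'cV[R]_n, x != 0 -> 0 < (x^T *m A *m x) 0 0.

Definition lemx A B := psdmx (B - A).

(* The symmetric positive definite square root; junk value 0 when A has none. *)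
Definition sqrtmx A : 'M[R]_n := xget 0 [set B | posdefmx B /\ B *m B = A].

End Matrices.

Section Calculus.
Variables (R : realType) (n : nat).

Definition basis_vec (i : 'I_n) : 'cV[R]_n := delta_mx i 0.

Definition C1 (W : normedModType R) (D : set 'cV[R]_n) (F : 'cV[R]_n -> W) :=
  forall x, D x -> differentiable F x /\
    forall i, {for x, continuous ('D_(basis_vec i) F)}.

(* For f valued in R^q, [grad p f x] is the matrix of the partial derivatives
   of f^t with respect to the coordinates selected by p: its (a, b) entry is
   the derivative of the b-th component of f in the (p a)-th coordinate. *)
Definition grad (r q : nat) (p : 'I_r -> 'I_n) (f : 'cV[R]_n -> 'cV[R]_q)
    (x : 'cV[R]_n) : 'M[R]_(r, q) :=
  \matrix_(a, b) 'D_(basis_vec (p a)) (fun t => f t b 0) x.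

End Calculus.

Section Family.
Variables (R : realType) (d : measure_display) (Y : measurableType d).
Variable mu : {measure set Y -> \bar R}.
Variables k k' : nat.
(* The parameter is the column (theta, theta~): the coordinates [lshift k' a]
   are those of the interest parameter, the coordinates [rshift k a] those of
   the nuisance parameter. Functions of the parameter are total; only their
   values on the open set Theta matter. *)
Local Notation param := 'cV[R]_(k + k').
Variable Theta : set param.
Variable m : param -> Y -> R.

Local Notation theta_coord := (@lshift k k').
Local Notation nuis_coord := (@rshift k k').

Definition Emx (r q : nat) (t : param) (F : Y -> 'M[R]_(r, q)) : 'M[R]_(r, q) :=
  \matrix_(i, j) \int[mu]_y (F y i j * m t y).

(* The expectation exists. Being integrable is required only up to equality
   almost everywhere, since the integrands may be derivatives in the parameter
   that exist (and are measurable) only off a null set. *)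
Definition has_Emx (r q : nat) (t : param) (F : Y -> 'M[R]_(r, q)) :=
  forall i j, exists2 h : Y -> R,
    mu.-integrable setT (fun y => (h y * m t y)%:E) &
    {ae mu, forall y, F y i j = h y}.

Definition inner (t : param) (h h' : Y -> R) : R :=
  \int[mu]_y (h y * h' y * m t y).

Definition HM : set (Y -> R) :=
  [set h : Y -> R | measurable_fun setT h /\
    forall t, Theta t -> (\int[mu]_y (h y ^+ 2 * m t y)%:E < +oo)%E].

Definition component (q : nat) (f : Y -> 'cV[R]_q) (a : 'I_q) : Y -> R :=
  fun y => f y a 0.

Definition lin_span (q : nat) (u : Y -> 'cV[R]_q) : set (Y -> R) :=
  [set v | exists c : 'I_q -> R, v = fun y => \sum_i c i * component u i y].

(* When the components of u are linearly dependent as elements of L2, the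
   projection is unique only up to equality almost everywhere. *)
Definition oproj1 (q : nat) (t : param) (u : Y -> 'cV[R]_q) (h : Y -> R) :
    Y -> R :=
  xget (cst 0) [set p : Y -> R | lin_span u p /\
    forall v, lin_span u v -> inner t (fun y => h y - p y) v = 0].

Definition oproj (q r : nat) (t : param) (u : Y -> 'cV[R]_q)
    (f : Y -> 'cV[R]_r) : Y -> 'cV[R]_r :=
  fun y => \col_a oproj1 t u (component f a) y.

Definition loglik (y : Y) (t : param) : R := ln (m t y).

Definition score_wrt (r : nat) (p : 'I_r -> 'I_(k + k')) (y : Y) (t : param) :
    'cV[R]_r :=
  \col_a 'D_(basis_vec R (p a)) (loglik y) t.

Definition score := score_wrt theta_coord.
Definition nuis_score := score_wrt nuis_coord.

Definition nuis_tangent (t : param) : set (Y -> R) :=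
  lin_span (nuis_score ^~ t).

Definition Hperp (t : param) : set (Y -> R) :=
  [set h : Y -> R | [/\ HM h, \int[mu]_y (h y * m t y) = 0 &
    forall v, nuis_tangent t v -> inner t h v = 0]].

Definition Vmx (f : Y -> param -> 'cV[R]_k) (t : param) : 'M[R]_k :=
  Emx t (fun y => f y t *m (f y t)^T).

Definition smooth_in_param (f : Y -> param -> 'cV[R]_k) :=
  {ae mu, forall y, C1 Theta (f y)}.

Definition regular_variance (f : Y -> param -> 'cV[R]_k) :=
  (forall t, Theta t -> posdefmx (Vmx f t)) /\ C1 Theta (Vmx f).

Definition generalized_estimator : set (Y -> param -> 'cV[R]_k) :=
  [set g | [/\ smooth_in_param g,
    forall t, Theta t -> forall a, Hperp t (component (g ^~ t) a) &
    regular_variance g]].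

Definition orthogonalize (f : Y -> param -> 'cV[R]_k) :
    Y -> param -> 'cV[R]_k :=
  fun y t => f y t - Emx t (f ^~ t) - oproj t (nuis_score ^~ t) (f ^~ t) y.

Definition orth_score := orthogonalize score.

Definition orth_info (t : param) : 'M[R]_k := Vmx orth_score t.

Definition diff_under_E (r : nat) (p : 'I_r -> 'I_(k + k')) :=
  forall f : Y -> param -> 'cV[R]_k,
    smooth_in_param f -> regular_variance f ->
    (forall t, Theta t -> forall a, HM (component (f ^~ t) a)) ->
  forall t, Theta t ->
    [/\ has_Emx t (f ^~ t),
        has_Emx t (fun y => grad p (f y) t),
        has_Emx t (fun y => score_wrt p y t *m (f y t)^T),
        forall a b,
          derivable (fun t' => Emx t' (f ^~ t') b 0) t (basis_vec R (p a)) &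
        grad p (fun t' => Emx t' (f ^~ t')) t =
          Emx t (fun y => grad p (f y) t)
          + Emx t (fun y => score_wrt p y t *m (f y t)^T)].

(* The family is M = m @` Theta, with the manifold structure carried over from
   Theta by the bijection m. No sigma-finiteness of mu is required: it follows
   from the existence of a positive integrable density. *)
Record regular_family : Prop := RegularFamily {
  param_open : open Theta ;
  param_inj : set_inj Theta m ;
  dens_measurable : forall t, Theta t -> measurable_fun setT (m t) ;
  dens_gt0 : forall t, Theta t -> forall y, 0 < m t y ;
  dens_total : forall t, Theta t -> (\int[mu]_y (m t y)%:E = 1)%E ;
  loglik_derivable : {ae mu, forall y, forall t, Theta t ->
    forall i, derivable (loglik y) t (basis_vec R i)} ;
  score_HM : forall t, Theta t -> forall a, HM (component (score ^~ t) a) ;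
  nuis_score_HM : forall t, Theta t ->
    forall a, HM (component (nuis_score ^~ t) a) ;
  score_E0 : forall t, Theta t -> Emx t (score ^~ t) = 0 ;
  nuis_score_E0 : forall t, Theta t -> Emx t (nuis_score ^~ t) = 0 ;
  orth_score_estimator : generalized_estimator orth_score ;
  diff_under_E_theta : diff_under_E theta_coord ;
  diff_under_E_nuis : diff_under_E nuis_coord }.

Definition standardize (g : Y -> param -> 'cV[R]_k) : Y -> param -> 'cV[R]_k :=
  fun y t => invmx (sqrtmx (Vmx g t)) *m g y t.

Definition info (g : Y -> param -> 'cV[R]_k) (t : param) : 'M[R]_k :=
  let A := Emx t (fun y => grad theta_coord (standardize g y) t) in A *m A^T.

Definition proj_on (g f : Y -> param -> 'cV[R]_k) : Y -> param -> 'cV[R]_k :=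
  fun y t => oproj t (g ^~ t) (f ^~ t) y.

Definition corr (g : Y -> param -> 'cV[R]_k) (t : param) : 'M[R]_k :=
  Emx t (fun y => standardize orth_score y t *m (standardize g y t)^T).

End Family.

(* Main.v *)
Require Import Defs.
From HB Require Import structures.
From mathcomp Require Import all_boot all_order all_algebra.
From mathcomp Require Import all_classical all_reals all_analysis.
From mathcomp Require Import measurable_realfun.
From mathcomp Require Import perm spectral complex.
From mathcomp Require Import ring lra.

Set Implicit Arguments.
Unset Strict Implicit.
Unset Printing Implicit Defensive.

Import Order.TTheory GRing.Theory Num.Theory.
Import numFieldNormedType.Exports.

Local Open Scope classical_set_scope.
Local Open Scope ring_scope.

(** Write [C] for the matrix of covariances of the score for the interest
    parameter with [g], and [V] for the variance of [g]. Everything in the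
    theorem is the quadratic expression [C V^-1 C^T].

    - [C] is also the covariance of the orthogonalized score with [g]
      ([gram_score]): orthogonalization subtracts a mean, which is zero, and a
      combination of the nuisance scores, to which [g] is orthogonal.
    - The standardized estimator [V^-1/2 g] has mean zero at every parameter,
      so differentiating the mean under the integral gives that the expected
      gradient of the standardized estimator is [- C V^-1/2]
      ([mean_grad_standardize]). Hence the information is [C V^-1 C^T]
      ([info_gram]).
    - The projection of a vector [f] on the span of [g] is
      [E(f g^T) V^-1 g] ([oprojE]), whose variance is again [C V^-1 C^T] when
      [f] is either of the two scores.
    - The bound says that the Schur complement [I - C V^-1 C^T] is positive
      semidefinite; it is the variance of the residual of the orthogonalized
      score after projection on [g] ([gram_schur_psdmx]). For the
      orthogonalized score itself, [C = V = I].

    The analytic difficulty is hidden in the second point. The interchange of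
    derivative and integral is granted only for functions that are
    continuously differentiable in the parameter, so one has to know that
    [V^-1/2] is a C^1 function of the parameter whenever [V] is
    ([C1_sqrtmx]). This rests on the existence of a positive definite square
    root, and on the bound [|X| <= c |S X + X T|] for positive definite [S]
    and [T], with a constant that depends on [S] only ([sylvester_bound]). As
    [S X + X T = T^2 - S^2] for [X = T - S], this bound makes the square root
    locally Lipschitz; expanding [(S + X)^2] to second order then gives its
    derivative as the solution [X] of the equation [S X + X S = dV], and the
    same bound gives the continuity of that derivative. *)

(** * Square roots of positive definite matrices *)

Section SquareRoot.
Variable R : realType.

Lemma interpolating_poly (F : fieldType) (f : F -> F) (s : seq F) :
  exists p : {poly F}, forall x, x \in s -> p.[x] = f x.
Proof.
elim: s => [|a s [p ps]]; first by exists 0.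
have [a_s|a_s] := boolP (a \in s).
  by exists p => x; rewrite inE => /orP[/eqP ->|]; exact: ps.
pose q : {poly F} := \prod_(b <- s) ('X - b%:P).
have qa : q.[a] != 0 by rewrite -[_ == _]/(root q a) root_prod_XsubC.
exists (p + ((f a - p.[a]) / q.[a])%:P * q) => x.
rewrite inE !hornerE => /orP[/eqP ->|xs]; first by rewrite divfK// subrKC.
have : root q x by rewrite root_prod_XsubC.
by move=> /eqP ->; rewrite mulr0 addr0 ps.
Qed.

Lemma dot_eq0 n (x : 'cV[R]_n) : ((x^T *m x) 0 0 == 0) = (x == 0).
Proof.
apply/eqP/eqP => [|->]; last by rewrite mulmx0 mxE.
rewrite mxE => /eqP; rewrite psumr_eq0; last by move=> i _; rewrite mxE -expr2 sqr_ge0.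
move=> /allP h; apply/matrixP => i j; rewrite ord1 mxE.
by have /(_ (mem_index_enum i)) := h i; rewrite mxE -expr2 sqrf_eq0 => /eqP.
Qed.

Lemma dot_ge0 n (x : 'cV[R]_n) : 0 <= (x^T *m x) 0 0.
Proof. by rewrite mxE sumr_ge0// => i _; rewrite mxE -expr2 sqr_ge0. Qed.

Lemma posdefmx_unit n (A : 'M[R]_n) : posdefmx A -> A \in unitmx.
Proof.
move=> [_ Apos]; rewrite unitmxE unitfE; apply/negP => /eqP/eqP/det0P [v v0 vA].
have := Apos v^T; rewrite trmx_eq0 v0 trmxK vA mul0mx mxE => /(_ isT).
by rewrite ltxx.
Qed.

Lemma posdefmx_sqr n (B : 'M[R]_n) : B^T = B -> B \in unitmx -> posdefmx (B *m B).
Proof.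
move=> Bsym Bu; split; first by rewrite trmx_mul Bsym.
move=> x x0; have -> : x^T *m (B *m B) *m x = (B *m x)^T *m (B *m x).
  by rewrite trmx_mul Bsym !mulmxA.
rewrite lt_neqAle dot_ge0 andbT eq_sym dot_eq0.
by apply: contra x0 => /eqP Bx; rewrite -[x](mulKmx Bu) Bx mulmx0.
Qed.

Lemma sym_horner_mx n (A : 'M[R]_n.+1) p : A^T = A -> (horner_mx A p)^T = horner_mx A p.
Proof.
move=> As; elim/poly_ind: p => [|p c ih]; first by rewrite rmorph0 trmx0.
rewrite rmorphD rmorphM /= horner_mx_X horner_mx_C linearD /= tr_scalar_mx.
congr (_ + _); rewrite [LHS]trmx_mul As ih; exact/esym/comm_horner_mx.
Qed.


Lemma exprmx_conj (F : fieldType) n (P E : 'M[F]_n.+1) j : P \in unitmx ->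
  (invmx P *m E *m P) ^+ j = invmx P *m E ^+ j *m P.
Proof.
move=> Pu; elim: j => [|j ih]; first by rewrite !expr0 mulmx1 mulVmx.
by rewrite !exprS ih -!mulmxE !mulmxA mulmxK.
Qed.

Lemma exprmx_diag (F : fieldType) n (d : 'rV[F]_n.+1) j :
  diag_mx d ^+ j = diag_mx (map_mx (fun x => x ^+ j) d).
Proof.
elim: j => [|j ih].
  by apply/matrixP => i i'; rewrite !expr0 !mxE expr0.
rewrite exprS ih -mulmxE mulmx_diag; congr diag_mx; apply/rowP => i.
by rewrite !mxE exprS.
Qed.

Lemma horner_mx_root (C : numClosedFieldType) n (A : 'M[C]_n.+1) (p : {poly C}) q :
  A \is normalmx ->
  (forall i, p.[spectral_diag A 0 i] ^+ q = spectral_diag A 0 i) ->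
  horner_mx A p ^+ q = A.
Proof.
move=> /orthomx_spectralP AE pq; have Pu := spectral_unit A.
rewrite {1}AE (horner_mx_uconjC _ _ Pu) (horner_mx_diag _ p).
rewrite (exprmx_conj _ _ Pu) exprmx_diag [RHS]AE.
by congr (_ *m diag_mx _ *m _); apply/rowP => i; rewrite !mxE pq.
Qed.

Lemma spectral_diag_eigenvalue (C : numClosedFieldType) n (A : 'M[C]_n) i :
  A \is normalmx -> eigenvalue A (spectral_diag A 0 i).
Proof.
move=> /orthomx_spectralP AE; have Pu := spectral_unit A.
apply/eigenvalueP; exists (row i (spectralmx A)).
  rewrite -row_mul {2}AE !mulmxA mulmxV// mul1mx row_mul.
  by rewrite row_diag_mx -scalemxAl -rowE.
apply/eqP => r0; move: Pu; rewrite -row_free_unit => /row_freeP [B PB].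
move: (congr1 (row i) PB); rewrite row_mul r0 mul0mx => /rowP /(_ i).
by rewrite !mxE eqxx => /esym/eqP; rewrite oner_eq0.
Qed.

(** A functional calculus: over the complex numbers the matrix is unitarily
    similar to a diagonal matrix, whose entries are eigenvalues of a real
    symmetric positive definite matrix, hence real and positive. A real
    polynomial that takes the required values at these finitely many points,
    evaluated at the matrix, is a root; having real coefficients, it stays
    over the real numbers, and it is symmetric as a polynomial in a symmetric
    matrix. *)
Lemma posdefmx_root n (A : 'M[R]_n.+1) (f : R -> R) (q : nat) : posdefmx A ->
  (forall r, 0 < r -> f r ^+ q = r) ->
  exists2 B : 'M[R]_n.+1, B^T = B & B ^+ q = A.
Proof.
move=> [Asym Apos] fq.
pose c := real_complex R : {rmorphism R -> R[i]}.
pose AC : 'M[R[i]]_n.+1 := map_mx c A.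
have Aherm : AC \is hermsymmx.
  apply: realsym_hermsym.
    by rewrite qualifE /= expr0 scale1r map_mx_id// /AC map_trmx Asym eqxx//.
  by apply/mxOverP => i j; rewrite mxE; apply/complex_realP; exists (A i j).
have Anormal := hermitian_normalmx Aherm.
have DR i : exists r, [/\ spectral_diag AC 0 i = c r & 0 < r].
  have [r Dr] : exists r, spectral_diag AC 0 i = c r.
    by have /mxOverP/(_ 0 i)/complex_realP := hermitian_spectral_diag_real Aherm.
  exists r; split => //.
  have := spectral_diag_eigenvalue i Anormal; rewrite Dr.
  rewrite eigenvalue_root_char -map_char_poly fmorph_root -eigenvalue_root_char.
  move=> /eigenvalueP [v vA v0].
  have := Apos v^T; rewrite trmx_eq0 v0 trmxK vA => /(_ isT).
  rewrite -scalemxAl mxE pmulr_lgt0//.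
  by rewrite lt_neqAle eq_sym -[v in v *m _]trmxK dot_eq0 dot_ge0 trmx_eq0 v0.
have [p pD] := interpolating_poly f
  [seq complex.Re z | z <- [seq spectral_diag AC 0 i | i <- enum 'I_n.+1]].
exists (horner_mx A p); first exact: sym_horner_mx.
apply: (@map_mx_inj _ _ c); rewrite rmorphXn /= map_horner_mx -/AC.
apply: horner_mx_root => // i.
have [r [Dr r0]] := DR i; rewrite Dr horner_map -rmorphXn pD ?fq//.
apply/mapP; exists (spectral_diag AC 0 i); last by rewrite Dr.
by apply/mapP; exists i; rewrite // mem_enum.
Qed.

(** A symmetric fourth root [C] exists by the functional calculus, and is
    invertible; then [C^2] is a square root and, being the square of an
    invertible symmetric matrix, is positive definite. *)
Lemma sqrtmxP n (A : 'M[R]_n) : (0 < n)%N -> posdefmx A ->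
  posdefmx (sqrtmx A) /\ sqrtmx A *m sqrtmx A = A.
Proof.
case: n A => // n A _ Apd.
suff [B] : exists B, [set B | posdefmx B /\ B *m B = A] B.
  by rewrite /sqrtmx; exact: xgetI.
have fourth (r : R) : 0 < r -> Num.sqrt (Num.sqrt r) ^+ 4 = r.
  by move=> r0; rewrite (exprM _ 2 2) !sqr_sqrtr ?sqrtr_ge0 ?ltW.
have [C Csym C4] := posdefmx_root Apd fourth.
have Cu : C \in unitmx.
  have := posdefmx_unit Apd; rewrite -C4 exprS -mulmxE unitmx_mul.
  by case/andP.
exists (C *m C); split; first exact: posdefmx_sqr.
by rewrite -C4 -[RHS]/(C ^+ (2 * 2)) exprM expr2.
Qed.

End SquareRoot.

(** * Continuously differentiable matrix-valued functions *)

Section C1Calculus.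
Variables (R : realType) (n : nat).
Local Notation V := 'cV[R]_n.
Implicit Types (W : normedModType R).

(** Differentiability at a point only depends on the first-order behaviour. *)
Lemma differentiable_remainder W (f g : V -> W) (x : V) :
  differentiable f x -> g x = f x ->
  (forall e, 0 < e -> \forall h \near (0 : V),
    `|g (h + x) - f (h + x)| <= e * `|h|) ->
  differentiable g x.
Proof.
move=> df gx small; have [dfc fE] := (diff_locallyP _ _).1 df.
have gE : g \o shift x = (cst (g x) + 'd f x : V -> W) +o_ (0 : V) (id : V -> V).
  apply: (iffRL (@eqaddoP R V W V (nbhs_filter_on (0 : V)) _ _ _)) => e e0.
  move/eqaddoP : fE => /(_ (e / 2)) /[!divr_gt0]// /(_ isT) fE.
  have e20 : 0 < e / 2 by rewrite divr_gt0.
  near=> h.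
  rewrite [leLHS](_ : _ = `|(g (h + x) - f (h + x)) + (f (h + x) - (f x + 'd f x h))|);
    last by rewrite addrA subrK /= !fctE /= gx.
  rewrite (le_trans (ler_normD _ _))// (splitr e) mulrDl lerD//.
    by near: h; exact: small.
  by near: h; exact: fE.
by apply/diff_locallyP; rewrite (diff_unique dfc gE).
Unshelve. all: by end_near. Qed.

Lemma near_eq_differentiable W (f g : V -> W) (x : V) :
  (\near x, f x = g x) -> differentiable f x -> differentiable g x.
Proof.
move=> fg df; apply: (differentiable_remainder df); first exact/esym/(nbhs_singleton fg).
move=> e e0; near=> h; suff -> : f (h + x) = g (h + x).
  by rewrite subrr normr0 mulr_ge0 // ltW.
near: h; move: fg; rewrite (near_shift 0)/=; apply: filterS => h.
by rewrite /= subr0.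
Unshelve. all: by end_near. Qed.

Lemma differentiable_locally_lipschitz W (f : V -> W) (x : V) : differentiable f x ->
  exists2 K, 0 < K & \forall h \near (0 : V), `|f (h + x) - f x| <= K * `|h|.
Proof.
move=> df; have [dfc /eqaddoP/(_ 1 ltr01) fE] := (diff_locallyP _ _).1 df.
have [K K0 dK] := linear_lipschitz dfc; exists (1 + K); first by rewrite addr_gt0.
near=> h.
have -> : f (h + x) - f x = (f (h + x) - (f x + 'd f x h)) + 'd f x h.
  by rewrite opprD addrA subrK.
rewrite (le_trans (ler_normD _ _))// mulrDl lerD//.
by near: h; exact: fE.
Unshelve. all: by end_near. Qed.

Lemma continuous_distP W (f : V -> W) (x : V) : {for x, continuous f} <->
  forall e, 0 < e -> \forall t \near x, `|f t - f x| <= e.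
Proof.
split=> [/cvgrPdist_le fc e e0|fc].
  by have := fc e e0; apply: filterS => t; rewrite distrC.
apply/(@cvgrPdist_le _ _ _ (nbhs x)) => e e0.
by have := fc e e0; apply: filterS => t; rewrite distrC.
Qed.

Variable D : set V.
Hypothesis Dopen : open D.

Lemma C1_ext W (f g : V -> W) : (forall x, D x -> f x = g x) -> C1 D f -> C1 D g.
Proof.
move=> fg fC x Dx; have [df cf] := fC x Dx.
have nearfg y : D y -> \forall z \near y, f z = g z.
  by move=> Dy; apply: filterS (open_nbhs_nbhs (conj Dopen Dy)); exact: fg.
split; first exact: near_eq_differentiable (nearfg _ Dx) df.
move=> i; have /near_eq_cvg : \forall y \near x,
    'D_(basis_vec R i) f y = 'D_(basis_vec R i) g y.
  apply: filterS (open_nbhs_nbhs (conj Dopen Dx)) => y Dy.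
  exact/near_eq_derive/nearfg.
by move=> /cvg_trans; apply; rewrite -(near_eq_derive _ (nearfg _ Dx)); exact: cf.
Qed.

(** Since [D] is open, the partial derivatives agree with the formulas [df] on
    a neighbourhood of each point of [D], so that continuity may be checked on
    the formulas. *)
Lemma C1_intro W (f : V -> W) (df : 'I_n -> V -> W) :
  (forall x, D x -> differentiable f x) ->
  (forall i x, D x -> 'D_(basis_vec R i) f x = df i x) ->
  (forall i x, D x -> {for x, continuous (df i)}) -> C1 D f.
Proof.
move=> fd fE dfc x Dx; split; first exact: fd.
move=> i; have /near_eq_cvg : \forall y \near x,
    df i y = 'D_(basis_vec R i) f y.
  by apply: filterS (open_nbhs_nbhs (conj Dopen Dx)) => y Dy; rewrite fE.
by move=> /cvg_trans; apply; rewrite fE//; exact: dfc.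
Qed.

Lemma C1_cst W (a : W) : C1 D (cst a).
Proof.
apply: (@C1_intro _ _ (fun _ => cst 0)) => [x _|i x _|i x _].
- exact: differentiable_cst.
- exact: (@derive_cst R V W a).
- exact: cst_continuous.
Qed.

Lemma C1D W (f g : V -> W) : C1 D f -> C1 D g -> C1 D (f + g).
Proof.
move=> fC gC; apply: (@C1_intro _ _
  (fun i => 'D_(basis_vec R i) f + 'D_(basis_vec R i) g)).
- by move=> x Dx; apply: differentiableD; [case: (fC x Dx)|case: (gC x Dx)].
- move=> i x Dx; rewrite deriveD//; apply: diff_derivable;
    [by case: (fC x Dx)|by case: (gC x Dx)].
- by move=> i x Dx; apply: continuousD; [case: (fC x Dx)|case: (gC x Dx)].
Qed.

Lemma C1M (f g : V -> R) : C1 D f -> C1 D g -> C1 D (f * g).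
Proof.
move=> fC gC; have fd x Dx := (fC x Dx).1; have gd x Dx := (gC x Dx).1.
apply: (@C1_intro _ _ (fun i => f * 'D_(basis_vec R i) g + g * 'D_(basis_vec R i) f)).
- by move=> x Dx; apply: differentiableM; [exact: fd|exact: gd].
- by move=> i x Dx; rewrite deriveM//; apply: diff_derivable; [exact: fd|exact: gd].
- move=> i x Dx; apply: continuousD; apply: continuousM.
  + exact: differentiable_continuous (fd _ Dx).
  + by case: (gC x Dx).
  + exact: differentiable_continuous (gd _ Dx).
  + by case: (fC x Dx).
Qed.

Lemma C1V (f : V -> R) : (forall x, D x -> f x != 0) -> C1 D f -> C1 D (fun x => (f x)^-1).
Proof.
move=> f0 fC; have fd x Dx := (fC x Dx).1.
apply: (@C1_intro _ _ (fun i x => - (f x) ^- 2 *: 'D_(basis_vec R i) f x)).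
- by move=> x Dx; apply: differentiableV; [exact: fd|exact: f0].
- by move=> i x Dx; rewrite deriveV ?f0//; exact/diff_derivable/fd.
- have fc x Dx := differentiable_continuous (fd x Dx).
  move=> i x Dx; apply: continuousM; last by case: (fC x Dx).
  apply: continuousN; apply: continuousV; first by rewrite expf_neq0// f0.
  by apply: (@continuousM _ _ f f); exact: fc.
Qed.

Lemma C1_sum W (I : Type) (s : seq I) (P : pred I) (f : I -> V -> W) :
  (forall i, C1 D (f i)) -> C1 D (\sum_(i <- s | P i) f i).
Proof.
move=> fC; elim/big_rec: _ => [|i g _ gC]; first exact: C1_cst.
exact: C1D.
Qed.

Lemma C1_prod (I : Type) (s : seq I) (P : pred I) (f : I -> V -> R) :
  (forall i, C1 D (f i)) -> C1 D (\prod_(i <- s | P i) f i).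
Proof.
move=> fC; elim/big_rec: _ => [|i g _ gC]; first exact: C1_cst.
exact: (C1M (fC i) gC).
Qed.

Lemma C1_mx p q (F : V -> 'M[R]_(p, q)) :
  C1 D F <-> forall i j, C1 D (fun x => F x i j).
Proof.
split=> [FC i j|FC].
  have Fd x Dx := (FC x Dx).1.
  apply: (@C1_intro _ _ (fun l x => ('D_(basis_vec R l) F x) i j)).
  - move=> x Dx; have := differentiable_coord (F x) i j.
    exact: (@differentiable_comp _ _ _ _ F (fun M => M i j) x (Fd _ Dx)).
  - by move=> l x Dx; rewrite derive_mx ?mxE//; exact/diff_derivable/Fd.
  - move=> l x Dx; have [_ /(_ l) c] := FC x Dx.
    have := @coord_continuous R p q i j ('D_(basis_vec R l) F x).
    exact: (@continuous_comp _ _ _ _ (fun M : 'M[R]_(p, q) => M i j) x c).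
have -> : F = \sum_i \sum_j (fun x => F x i j *: delta_mx i j).
  apply/funext => x; rewrite {1}(matrix_sum_delta (F x)) fct_sumE.
  by apply: eq_bigr => i _; rewrite fct_sumE.
apply: C1_sum => i; apply: C1_sum => j.
have Fd x Dx := (FC i j x Dx).1.
apply: (@C1_intro _ _
  (fun l x => ('D_(basis_vec R l) (fun x => F x i j) x) *: delta_mx i j)).
- by move=> x Dx; apply: differentiableZl; exact: Fd.
- move=> l x Dx; rewrite deriveE; last exact/differentiableZl/Fd.
  by rewrite diffZl ?deriveE//; exact: Fd.
- move=> l x Dx; have [_ /(_ l) c] := FC i j x Dx.
  exact: continuousZr_tmp.
Qed.

Lemma C1_mulmx p q r (F : V -> 'M[R]_(p, q)) (G : V -> 'M[R]_(q, r)) :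
  C1 D F -> C1 D G -> C1 D (fun x => F x *m G x).
Proof.
move=> /C1_mx FC /C1_mx GC; apply/C1_mx => i j.
have -> : (fun x => (F x *m G x) i j) =
    \sum_k ((fun x => F x i k) * (fun x => G x k j)).
  by apply/funext => x; rewrite mxE fct_sumE.
by apply: C1_sum => k; exact: C1M.
Qed.

Lemma C1_det p (F : V -> 'M[R]_p) : C1 D F -> C1 D (fun x => \det (F x)).
Proof.
move=> /C1_mx FC.
have -> : (fun x => \det (F x)) =
    \sum_(s : 'S_p) (cst ((-1) ^+ s) * \prod_i (fun x => F x i (s i))).
  by apply/funext => x; rewrite /determinant fct_sumE; apply: eq_bigr => s _;
     rewrite /= fctE /= fct_prodE.
by apply: C1_sum => s; apply: C1M; [exact: C1_cst|apply: C1_prod => i; exact: FC].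
Qed.

(** By Cramer's rule the inverse is a rational function of the entries. *)
Lemma C1_invmx p (F : V -> 'M[R]_p) : (forall x, D x -> F x \in unitmx) ->
  C1 D F -> C1 D (fun x => invmx (F x)).
Proof.
move=> Fu FC; apply: (@C1_ext _ (fun x => (\det (F x))^-1 *: \adj (F x))).
  by move=> x Dx; rewrite /invmx Fu.
apply/C1_mx => i j.
have -> : (fun x => ((\det (F x))^-1 *: \adj (F x)) i j) =
    (fun x => (\det (F x))^-1) *
    (cst ((-1) ^+ (j + i)) * (fun x => \det (row' j (col' i (F x))))).
  by apply/funext => x; rewrite !mxE.
apply: C1M; first by apply: C1V (C1_det FC) => x Dx; rewrite -unitfE -unitmxE Fu.
apply: C1M; first exact: C1_cst.
apply: C1_det; apply/C1_mx => a b; move/C1_mx : FC => /(_ (lift j a) (lift i b)).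
by apply: C1_ext => x _; rewrite !mxE.
Qed.

Lemma derive_mulmx p q r (F : V -> 'M[R]_(p, q)) (G : V -> 'M[R]_(q, r)) x v :
  derivable F x v -> derivable G x v ->
  'D_v (fun y => F y *m G y) x = 'D_v F x *m G x + F x *m 'D_v G x.
Proof.
move=> dF dG; have dF' := (derivable_mxP _ _ _).1 dF; have dG' := (derivable_mxP _ _ _).1 dG.
have FGE i j : (fun y => (F y *m G y) i j) =
    \sum_k ((fun y => F y i k) * (fun y => G y k j)).
  by apply/funext => y; rewrite mxE fct_sumE.
have dFG i j k : derivable ((fun y => F y i k) * (fun y => G y k j)) x v.
  exact: derivableM.
rewrite derive_mx; last first.
  apply/derivable_mxP => i j; rewrite FGE; apply: derivable_sum => k; exact: dFG.
apply/matrixP => i j; rewrite !mxE FGE derive_sum; last by move=> k; exact: dFG.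
rewrite -big_split /=; apply: eq_bigr => k _.
rewrite deriveM// !derive_mx// !mxE addrC; congr (_ + _); exact: mulrC.
Qed.

End C1Calculus.

(** * The Sylvester equation S X + X T = Y *)

Section Sylvester.
Variables (R : realType) (k : nat).
Implicit Types A B S T X Y Z : 'M[R]_k.

Lemma mxnorm_coord p q (X : 'M[R]_(p, q)) i j : `|X i j| <= `|X|.
Proof.
rewrite [leRHS]/Num.norm/= mx_normrE.
exact: (le_bigmax _ (fun ij => `|X ij.1 ij.2|) (i, j)).
Qed.

Lemma mxnorm_le p q (X : 'M[R]_(p, q)) e : 0 <= e ->
  (forall i j, `|X i j| <= e) -> `|X| <= e.
Proof.
move=> e0 Xe; rewrite [leLHS]/Num.norm/= mx_normrE bigmax_le// => -[i j] _.
Qed.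

Lemma mxnorm_mul X Y : `|X *m Y| <= k%:R * `|X| * `|Y|.
Proof.
apply: mxnorm_le => [|i j]; first by rewrite !mulr_ge0.
rewrite mxE (le_trans (ler_norm_sum _ _ _))//.
rewrite (@le_trans _ _ (\sum_(l < k) `|X| * `|Y|))//.
  by apply: ler_sum => l _; rewrite normrM ler_pM ?mxnorm_coord.
by rewrite sumr_const card_ord -mulrA mulr_natl.
Qed.

Lemma frobenius_ge X : `|X| ^+ 2 <= \tr (X^T *m X).
Proof.
have tr0 : 0 <= \tr (X^T *m X).
  by rewrite sumr_ge0// => j _; rewrite mxE sumr_ge0// => i _; rewrite mxE -expr2 sqr_ge0.
have -> : \tr (X^T *m X) = Num.sqrt (\tr (X^T *m X)) ^+ 2 by rewrite sqr_sqrtr.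
rewrite lerXn2r ?nnegrE ?sqrtr_ge0//.
apply: mxnorm_le => [|i j]; first exact: sqrtr_ge0.
rewrite -sqrtr_sqr ler_wsqrtr// /mxtrace (bigD1 j)//= mxE (bigD1 i)//= mxE -expr2.
rewrite -addrA lerDl addr_ge0 ?sumr_ge0// => [l _|l _].
  by rewrite mxE -expr2 sqr_ge0.
by rewrite mxE sumr_ge0// => l' _; rewrite mxE -expr2 sqr_ge0.
Qed.

Lemma frobenius_le X Y : \tr (X^T *m Y) <= k%:R ^+ 2 * `|X| * `|Y|.
Proof.
rewrite (@le_trans _ _ (\sum_(j < k) k%:R * (`|X| * `|Y|)))//; last first.
  by rewrite sumr_const card_ord -[leLHS]mulr_natl expr2 -!mulrA.
apply: ler_sum => j _; rewrite mxE (le_trans (ler_norm _))//.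
rewrite (le_trans (ler_norm_sum _ _ _))//.
rewrite (@le_trans _ _ (\sum_(l < k) `|X| * `|Y|))//.
  by apply: ler_sum => l _; rewrite normrM mxE ler_pM ?mxnorm_coord.
by rewrite sumr_const card_ord mulr_natl.
Qed.

Lemma posdefmx_ge0 A (x : 'cV[R]_k) : posdefmx A -> 0 <= (x^T *m A *m x) 0 0.
Proof.
move=> [_ Apos]; have [->|/Apos/ltW//] := eqVneq x 0.
by rewrite mulmx0 mxE.
Qed.

Lemma mxtrace_posdefmx_ge0 A X : posdefmx A -> 0 <= \tr (X *m (A *m X^T)).
Proof.
move=> Apd; rewrite /mxtrace sumr_ge0// => i _.
suff -> : (X *m (A *m X^T)) i i = (((row i X)^T)^T *m A *m (row i X)^T) 0 0.
  exact: posdefmx_ge0.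
rewrite trmxK tr_row -mulmxA !mxE; apply: eq_bigr => l _; rewrite !mxE.
by congr (_ * _); apply: eq_bigr => l' _; rewrite !mxE.
Qed.

Hypothesis k_gt0 : (0 < k)%N.

(** Pair [Y = S X + X T] with [X] for the Frobenius product: with [C] the
    square root of [S], the trace of [X^T Y] is the squared Frobenius norm of
    [C X] plus the trace of [X T X^T], which is nonnegative. So the squared
    norm of [C X], and with it that of [X = C^-1 (C X)], is at most a multiple
    of [|X| |Y|]. The constant does not depend on [T]: this uniformity is what
    gives continuity of the square root, where [T] is the root at a moving
    point. *)
Lemma sylvester_bound S : posdefmx S -> exists2 c : R, 0 < c &
  forall T X, posdefmx T -> `|X| <= c * `|S *m X + X *m T|.
Proof.
move=> Spd; have [Cpd CC] := sqrtmxP k_gt0 Spd; set C := sqrtmx S in Cpd CC.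
have Cu := posdefmx_unit Cpd.
have C0 : 0 < `|invmx C|.
  rewrite normr_gt0; apply/eqP => C0.
  have : (1%:M : 'M[R]_k) = 0 by rewrite -(mulVmx Cu) C0 mul0mx.
  move=> /matrixP/(_ (Ordinal k_gt0) (Ordinal k_gt0)) /eqP.
  by rewrite !mxE eqxx oner_eq0.
have kR : 0 < k%:R :> R by rewrite ltr0n.
exists (k%:R ^+ 4 * `|invmx C| ^+ 2) => [|T X Tpd].
  by rewrite mulr_gt0// exprn_gt0.
have [->|X0] := eqVneq X 0; first by rewrite normr0 mulr_ge0// mulr_ge0 ?exprn_ge0.
set Y := S *m X + X *m T.
have trY : \tr ((C *m X)^T *m (C *m X)) <= \tr (X^T *m Y).
  rewrite /Y mulmxDr mxtraceD trmx_mul Cpd.1 -CC !mulmxA lerDl.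
  by rewrite -mulmxA mxtrace_mulC -mulmxA mxtrace_posdefmx_ge0.
have XC : `|X| <= k%:R * `|invmx C| * `|C *m X|.
  by rewrite -{1}[X](mulKmx Cu) mxnorm_mul.
have : `|X| ^+ 2 <= (k%:R ^+ 4 * `|invmx C| ^+ 2 * `|Y|) * `|X|.
  rewrite (@le_trans _ _ ((k%:R * `|invmx C|) ^+ 2 * `|C *m X| ^+ 2))//.
    by rewrite -exprMn lerXn2r// nnegrE ?mulr_ge0.
  have -> : k%:R ^+ 4 * `|invmx C| ^+ 2 * `|Y| * `|X| =
      (k%:R * `|invmx C|) ^+ 2 * (k%:R ^+ 2 * `|X| * `|Y|) by ring.
  rewrite ler_pM2l ?exprn_gt0 ?mulr_gt0//.
  by rewrite (le_trans (frobenius_ge _))// (le_trans trY)// frobenius_le.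
by rewrite expr2 ler_pM2r// normr_gt0.
Qed.

End Sylvester.

(** * Smoothness of the square root *)

Lemma le_absorb (R : realFieldType) (x y z e : R) :
  x <= y + z -> y <= x / 2 -> z <= e / 2 -> x <= e.
Proof. by lra. Qed.

Section SqrtC1.
Variables (R : realType) (n k : nat) (k_gt0 : (0 < k)%N).
Variables (D : set 'cV[R]_n) (Dopen : open D) (A : 'cV[R]_n -> 'M[R]_k).
Hypotheses (AC1 : C1 D A) (Apd : forall t, D t -> posdefmx (A t)).
Local Notation S := (fun t => sqrtmx (A t)).

Let Spd t : D t -> posdefmx (S t).
Proof. by move=> /Apd /(sqrtmxP k_gt0) []. Qed.

Let SS t : D t -> S t *m S t = A t.
Proof. by move=> /Apd /(sqrtmxP k_gt0) []. Qed.

Let near_D x : D x -> \forall t \near x, D t.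
Proof. by move=> Dx; exact: (open_nbhs_nbhs (conj Dopen Dx)). Qed.

(** The bound for [S x] makes [X |-> S x X + X S x] injective, hence bijective
    in finite dimension, and its inverse bounded. *)
Lemma sylvester_inverse x : D x -> exists2 L : {linear 'M[R]_k -> 'M[R]_k},
  continuous L & forall Y, S x *m L Y + L Y *m S x = Y.
Proof.
move=> Dx; have [c c0 cS] := sylvester_bound k_gt0 (Spd Dx).
pose f := linfun (fun X : 'M[R]_k => S x *m X + X *m S x).
have flin : linear (fun X : 'M[R]_k => S x *m X + X *m S x).
  by move=> a X Y; rewrite mulmxDr mulmxDl -scalemxAr -scalemxAl scalerDr addrACA.
have fE X : f X = S x *m X + X *m S x.
  pose h := HB.pack_for {linear 'M[R]_k -> 'M[R]_k} (fun X : 'M[R]_k => S x *m X + X *m S x)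
    (GRing.isLinear.Build _ _ _ _ _ flin).
  by rewrite (lfunE h).
have finj : lker f == 0%VS.
  apply/lker0P => X Y fXY; apply/subr0_eq/eqP; rewrite -normr_le0.
  by rewrite (le_trans (cS _ _ (Spd Dx)))// -fE linearB /= fXY subrr normr0 mulr0.
exists (f^-1)%VF; last by move=> Y; rewrite -fE lker0_lfunVK.
apply/linear_bounded_continuous/linear_boundedP; near=> r => Y.
rewrite (le_trans (cS _ (f^-1%VF Y) (Spd Dx)))// -fE lker0_lfunVK//.
rewrite ler_wpM2r//; near: r; apply: nbhs_pinfty_ge; exact: num_real.
Unshelve. all: by end_near. Qed.

(** The increment [X] of the root solves
    [S x X + X S t = A t - A x]. *)
Lemma sqrtmx_lipschitz x : D x -> exists2 c, 0 < c &
  forall t, D t -> `|S t - S x| <= c * `|A t - A x|.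
Proof.
move=> Dx; have [c c0 cS] := sylvester_bound k_gt0 (Spd Dx); exists c => // t Dt.
rewrite (le_trans (cS _ _ (Spd Dt)))// mulmxBr mulmxBl !SS//.
by rewrite addrC addrA subrK.
Qed.

Lemma sqrtmx_continuous x : D x -> {for x, continuous S}.
Proof.
move=> Dx; have [c c0 cS] := sqrtmx_lipschitz Dx.
have /continuous_distP Ac := differentiable_continuous (AC1 Dx).1.
apply/continuous_distP => e e0; near=> t.
have Dt : D t by near: t; exact: near_D.
rewrite (le_trans (cS _ Dt))// -ler_pdivlMl// mulrC.
by near: t; apply: Ac; rewrite divr_gt0.
Unshelve. all: by end_near. Qed.

(** The increment [X] of the root satisfies
    [S x X + X S x = (A t - A x) - X^2], and [X^2] is of second order by the
    Lipschitz bound. Up to second order, [X] is therefore the solution of the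
    linear equation with right-hand side [A t - A x], which is differentiable
    in [t]. *)
Lemma sqrtmx_differentiable x : D x -> differentiable S x.
Proof.
move=> Dx; have [L Lc LE] := sylvester_inverse Dx.
have [c c0 cS] := sylvester_bound k_gt0 (Spd Dx).
have [b b0 bS] := sqrtmx_lipschitz Dx.
have Ad := (AC1 Dx).1.
have [K K0 AK] := differentiable_locally_lipschitz Ad.
apply: (@differentiable_remainder _ _ _ (fun t => S x + L (A t - A x))).
- apply: differentiableD; first exact: differentiable_cst.
  apply: (@differentiable_comp _ _ _ _ (fun t => A t - A x) L).
    by apply: differentiableB => //; exact: differentiable_cst.
  exact: linear_differentiable.
- by rewrite subrr linear0 addr0.
move=> e e0; near=> h.
have Dh : D (h + x).
  near: h; have := near_D Dx; rewrite (near_shift 0)/=; apply: filterS => h.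
  by rewrite /= subr0.
set X := S (h + x) - S x.
have AE : A (h + x) - A x = S x *m X + X *m S x + X *m X.
  have SE : S (h + x) = S x + X by rewrite /X subrKC.
  rewrite -{1}(SS Dh) -{1}(SS Dx) SE mulmxDl !mulmxDr.
  move: (S x *m S x) (S x *m X) (X *m S x) (X *m X).
  by move=> *; apply/matrixP => a b'; rewrite !mxE; ring.
have -> : S (h + x) - (S x + L (A (h + x) - A x)) = X - L (A (h + x) - A x).
  by rewrite opprD addrA.
set Z := X - _.
have ZE : S x *m Z + Z *m S x = - (X *m X).
  rewrite mulmxBr mulmxBl addrACA -opprD LE AE.
  by rewrite [- (_ + X *m X)]opprD addrA subrr sub0r.
rewrite (le_trans (cS _ _ (Spd Dx)))// ZE normrN.
rewrite (le_trans (ler_wpM2l (ltW c0) (mxnorm_mul _ _)))//.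
have XK : `|X| <= b * K * `|h|.
  rewrite (le_trans (bS _ Dh))// -mulrA ler_pM2l//.
  by near: h; exact: AK.
rewrite -mulrA.
rewrite (@le_trans _ _ (c * (k%:R * ((b * K * `|h|) * (b * K * `|h|)))))//.
  by rewrite ler_pM2l// ler_wpM2l// ler_pM.
have -> : c * (k%:R * (b * K * `|h| * (b * K * `|h|))) =
  (c * k%:R * (b * K) ^+ 2 * `|h|) * `|h| by ring.
rewrite ler_wpM2r// -ler_pdivlMl; last first.
  by rewrite !mulr_gt0// ?ltr0n// exprn_gt0// mulr_gt0.
near: h; apply: (@nbhs0_le R 'cV[R]_n).
by rewrite mulr_gt0// invr_gt0 !mulr_gt0// ?ltr0n// exprn_gt0// mulr_gt0.
Unshelve. all: by end_near. Qed.

(** Differentiating [S t *m S t = A t], a partial derivative [X] of the root at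
    [t] solves [S t X + X S t = D A t]. Compared with the same equation at
    [x], its distance to the derivative [X0] at [x] is bounded through the
    Sylvester bound at the fixed point [x]; the bound contains [X] itself, but
    with a factor [|S t - S x|], so that this part can be absorbed. *)
Lemma C1_sqrtmx : C1 D S.
Proof.
move=> x Dx; split; first exact: sqrtmx_differentiable.
move=> i; have Ad t : D t -> differentiable A t by move=> /AC1 [].
set e := basis_vec R i.
have DS t : D t -> S t *m 'D_e S t + 'D_e S t *m S t = 'D_e A t.
  move=> Dt; have Sd : derivable S t e by exact/diff_derivable/sqrtmx_differentiable.
  rewrite addrC -(derive_mulmx Sd Sd); apply: near_eq_derive.
  by apply: filterS (near_D Dt) => y Dy; rewrite SS.
have [c c0 cS] := sylvester_bound k_gt0 (Spd Dx).
have [_ /(_ i)/continuous_distP DAc] := AC1 Dx; rewrite -/e in DAc.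
have /continuous_distP Sc := sqrtmx_continuous Dx.
set X0 := 'D_e S x.
apply/continuous_distP => eps eps0.
have kR : 0 < k%:R :> R by rewrite ltr0n.
(* With |S t - S x| <= d1, the term of the estimate that contains |X - X0| is
   at most half of |X - X0|; with |S t - S x| and |D A t - D A x| at most d2,
   the other terms add up to at most eps / 2. *)
pose d1 := (4 * c * k%:R)^-1.
pose d2 := eps / (2 * c * (1 + 2 * k%:R * `|X0|)).
have q0 : 0 < 1 + 2 * k%:R * `|X0| by rewrite ltr_wpDr// !mulr_ge0.
have d10 : 0 < d1 by rewrite invr_gt0 !mulr_gt0.
have d20 : 0 < d2 by rewrite divr_gt0// !mulr_gt0.
near=> t.
have Dt : D t by near: t; exact: near_D.
have S1 : `|S t - S x| <= d1 by near: t; exact: Sc.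
have S2 : `|S t - S x| <= d2 by near: t; exact: Sc.
have A2 : `|'D_e A t - 'D_e A x| <= d2 by near: t; exact: DAc.
set X := 'D_e S t; set E := S t - S x.
have YE : S x *m (X - X0) + (X - X0) *m S x =
  ('D_e A t - 'D_e A x) - (E *m X + X *m E).
  rewrite -!DS// -/X -/X0 /E !mulmxBr !mulmxBl.
  have regroup (a a0 b b0 p q : 'M[R]_k) : (a - a0) + (b - b0) =
      (p + q - (a0 + b0)) - ((p - a) + (q - b)).
    by apply/matrixP => i' j; rewrite !mxE; ring.
  exact: regroup.
have := cS _ (X - X0) (Spd Dx); rewrite YE.
set x1 := `|X - X0| => x1le.
have XX : `|X| <= x1 + `|X0| by rewrite -{1}[X](subrK X0) ler_normD.
have EX : `|E *m X + X *m E| <= 2 * k%:R * `|E| * (x1 + `|X0|).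
  rewrite (le_trans (ler_normD _ _))//.
  rewrite (le_trans (lerD (mxnorm_mul _ _) (mxnorm_mul _ _)))//.
  have -> : k%:R * `|E| * `|X| + k%:R * `|X| * `|E| = 2 * k%:R * `|E| * `|X| by ring.
  by rewrite ler_wpM2l// !mulr_ge0.
have {x1le} x1le : x1 <= c * (d2 + 2 * k%:R * `|E| * (x1 + `|X0|)).
  rewrite (le_trans x1le)// ler_pM2l// (le_trans (ler_normB _ _))//.
  exact: lerD.
have x10 : 0 <= x1 by exact: normr_ge0.
have Ed1 : c * (2 * k%:R * `|E| * x1) <= x1 / 2.
  have -> : c * (2 * k%:R * `|E| * x1) = (2 * c * k%:R * `|E|) * x1 by ring.
  rewrite mulrC ler_wpM2l// (le_trans (ler_wpM2l _ S1)) ?mulr_ge0 ?(ltW c0)//.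
  rewrite le_eqVlt; apply/orP; left; apply/eqP.
  by rewrite /d1; field; rewrite !gt_eqF.
have Ed2 : c * (d2 + 2 * k%:R * `|E| * `|X0|) <= eps / 2.
  rewrite (@le_trans _ _ (c * (d2 + 2 * k%:R * d2 * `|X0|)))//.
    by rewrite ler_pM2l// lerD2l ler_wpM2r// ler_wpM2l// mulr_ge0.
  rewrite le_eqVlt; apply/orP; left; apply/eqP.
  by rewrite /d2; field; rewrite !gt_eqF.
by apply: (le_absorb _ Ed1 Ed2); rewrite -mulrDr addrCA -mulrDr.
Unshelve. all: by end_near. Qed.

End SqrtC1.

(** * Gram matrices of square integrable vectors *)

Section Gram.
Variables (R : realType) (d : measure_display) (Y : measurableType d).
Variables (mu : {measure set Y -> \bar R}) (w : Y -> R).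
Hypotheses (w_meas : measurable_fun setT w) (w_ge0 : forall y, 0 <= w y).

Definition square_integrable (h : Y -> R) :=
  measurable_fun setT h /\ (\int[mu]_y (h y ^+ 2 * w y)%:E < +oo)%E.

Lemma square_integrableP h : square_integrable h <->
  measurable_fun setT h /\ mu.-integrable setT (fun y => (h y ^+ 2 * w y)%:E).
Proof.
have absE y : (`|(h y ^+ 2 * w y)%:E| = (h y ^+ 2 * w y)%:E)%E.
  by rewrite gee0_abs// lee_fin mulr_ge0// sqr_ge0.
split=> -[hm hi]; split => //.
  apply/integrableP; split; last by under eq_integral do rewrite absE.
  by apply/measurable_EFinP/measurable_funM => //; exact: measurable_funX.
by case/integrableP : hi => _; under eq_integral do rewrite absE.
Qed.

Lemma integrable_prod h h' : square_integrable h -> square_integrable h' ->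
  mu.-integrable setT (fun y => (h y * h' y * w y)%:E).
Proof.
move=> /square_integrableP[hm hi] /square_integrableP[h'm h'i].
apply: (le_integrable _ _ _ (integrableD measurableT hi h'i)) => //.
  by apply/measurable_EFinP; do 2!apply: measurable_funM => //.
move=> y _; rewrite /= lee_fin -mulrDl !normrM ler_wpM2r//.
have := sqr_ge0 (`|h y| - `|h' y|); rewrite sqrrB !real_normK ?num_real// => sq.
rewrite [leRHS]ger0_norm ?addr_ge0 ?sqr_ge0//.
have : 0 <= `|h y| * `|h' y| by rewrite mulr_ge0.
by move: sq; rewrite -mulr_natr; lra.
Qed.

Lemma square_integrable_lin a h h' : square_integrable h -> square_integrable h' ->
  square_integrable (fun y => a * h y + h' y).
Proof.
move=> hs h's; have [hm _] := hs; have [h'm _] := h's.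
apply/square_integrableP; split.
  by apply: measurable_funD => //; exact: measurable_funM.
have -> : (fun y => ((a * h y + h' y) ^+ 2 * w y)%:E) =
    (fun y => (a ^+ 2)%:E * (h y * h y * w y)%:E)%E \+
    ((fun y => (2 * a)%:E * (h y * h' y * w y)%:E)%E \+
    (fun y => (h' y * h' y * w y)%:E)).
  by apply/funext => y /=; rewrite -!EFinM -!EFinD; congr EFin; ring.
apply: integrableD => //; last apply: integrableD => //.
- by apply: integrableZl => //; exact: integrable_prod.
- by apply: integrableZl => //; exact: integrable_prod.
- exact: integrable_prod.
Qed.

Lemma square_integrable0 : square_integrable (fun=> 0).
Proof.
split; first exact: measurable_cst.
by under eq_integral do rewrite expr2 !mul0r; rewrite integral0 ltry.
Qed.

Definition square_integrable_vec p (f : Y -> 'cV[R]_p) :=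
  forall a, square_integrable (component f a).

Lemma square_integrable_mul p q (M : 'M[R]_(q, p)) (f : Y -> 'cV[R]_p) :
  square_integrable_vec f -> square_integrable_vec (fun y => M *m f y).
Proof.
move=> fs a; have -> : component (fun y => M *m f y) a =
    (fun y => \sum_i M a i * component f i y).
  by apply/funext => y; rewrite /component mxE.
elim: (index_enum _) => [|i s ih].
  by under eq_fun do rewrite big_nil; exact: square_integrable0.
by under eq_fun do rewrite big_cons; exact: square_integrable_lin.
Qed.

Lemma square_integrableB p (f g : Y -> 'cV[R]_p) :
  square_integrable_vec f -> square_integrable_vec g ->
  square_integrable_vec (fun y => f y - g y).
Proof.
move=> fs gs a; have -> : component (fun y => f y - g y) a =
    (fun y => -1 * component g a y + component f a y).
  by apply/funext => y; rewrite /component !mxE mulN1r addrC.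
exact: square_integrable_lin.
Qed.

Definition gram p q (f : Y -> 'cV[R]_p) (g : Y -> 'cV[R]_q) : 'M[R]_(p, q) :=
  \matrix_(i, j) \int[mu]_y (f y i 0 * g y j 0 * w y).

Lemma tr_gram p q (f : Y -> 'cV[R]_p) (g : Y -> 'cV[R]_q) : (gram f g)^T = gram g f.
Proof.
by apply/matrixP => i j; rewrite !mxE; apply: eq_Rintegral => y _; rewrite [f y _ _ * _]mulrC.
Qed.

Lemma integral_lin p (c : 'I_p -> R) (F : 'I_p -> Y -> R) :
  (forall i, mu.-integrable setT (EFin \o F i)) ->
  \int[mu]_y (\sum_i c i * F i y) = \sum_i c i * \int[mu]_y F i y.
Proof.
move=> Fi.
suff [_ //] : mu.-integrable setT (EFin \o (fun y => \sum_i c i * F i y)) /\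
  \int[mu]_y (\sum_i c i * F i y) = \sum_i c i * \int[mu]_y F i y.
elim: (index_enum _) => [|i s [ih1 ih2]].
  rewrite big_nil; under eq_fun do rewrite big_nil.
  by split; [exact: integrable0|rewrite Rintegral_cst// mul0r].
have cF : mu.-integrable setT (EFin \o (fun y => c i * F i y)).
  exact: (integrableZl measurableT _ (Fi i)).
rewrite big_cons; under eq_fun do rewrite big_cons; split.
  exact: (integrableD measurableT cF ih1).
by rewrite RintegralD// RintegralZl// ih2.
Qed.

Lemma gram_mull p q r (M : 'M[R]_(q, p)) (f : Y -> 'cV[R]_p) (g : Y -> 'cV[R]_r) :
  square_integrable_vec f -> square_integrable_vec g ->
  gram (fun y => M *m f y) g = M *m gram f g.
Proof.
move=> fs gs; apply/matrixP => i j; rewrite !mxE.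
under [RHS]eq_bigr do rewrite mxE.
rewrite -(@integral_lin _ (M i) (fun l y => f y l 0 * g y j 0 * w y)); last first.
  by move=> l; exact: integrable_prod (fs l) (gs j).
apply: eq_Rintegral => y _; rewrite mxE !mulr_suml.
by apply: eq_bigr => l _; rewrite !mulrA.
Qed.

Lemma gram_mulr p q r (M : 'M[R]_(q, p)) (f : Y -> 'cV[R]_r) (g : Y -> 'cV[R]_p) :
  square_integrable_vec f -> square_integrable_vec g ->
  gram f (fun y => M *m g y) = gram f g *m M^T.
Proof. by move=> fs gs; rewrite -tr_gram gram_mull// trmx_mul tr_gram. Qed.

Lemma gramBl p q (f f' : Y -> 'cV[R]_p) (g : Y -> 'cV[R]_q) :
  square_integrable_vec f -> square_integrable_vec f' -> square_integrable_vec g ->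
  gram (fun y => f y - f' y) g = gram f g - gram f' g.
Proof.
move=> fs f's gs; apply/matrixP => i j; rewrite !mxE -RintegralB//; last 2 first.
- exact: integrable_prod (fs i) (gs j).
- exact: integrable_prod (f's i) (gs j).
by apply: eq_Rintegral => y _; rewrite !mxE !mulrBl.
Qed.

Lemma gram_psdmx p (f : Y -> 'cV[R]_p) : square_integrable_vec f -> psdmx (gram f f).
Proof.
move=> fs; split=> [|x]; first exact: tr_gram.
have xfs : square_integrable_vec (fun y => x^T *m f y) by exact: square_integrable_mul.
rewrite -[x in _ *m x]trmxK -gram_mull// -gram_mulr// mxE.
by apply: Rintegral_ge0 => y _; rewrite mulr_ge0// -expr2 sqr_ge0.
Qed.

(** The Schur complement is the Gram matrix of the residual [r] of the
    projection of [f] on [g], since [r] is orthogonal to [g]. *)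
Lemma gram_schur_psdmx p q (f : Y -> 'cV[R]_p) (g : Y -> 'cV[R]_q) :
  square_integrable_vec f -> square_integrable_vec g -> gram g g \in unitmx ->
  psdmx (gram f f - gram f g *m invmx (gram g g) *m (gram f g)^T).
Proof.
move=> fs gs gu; set M := gram f g *m invmx (gram g g).
have Mgs : square_integrable_vec (fun y => M *m g y) by exact: square_integrable_mul.
pose r y := f y - M *m g y.
have rs : square_integrable_vec r by exact: square_integrableB.
have rg : gram r g = 0 by rewrite gramBl// gram_mull// mulmxKV// subrr.
have rf : gram r f = gram f f - M *m (gram f g)^T by rewrite gramBl// gram_mull// tr_gram.
suff <- : gram r r = gram f f - M *m (gram f g)^T by exact: gram_psdmx.
have rr : gram r r = gram f r.
  by rewrite [LHS]gramBl// gram_mull// -[gram g r]tr_gram rg trmx0 mulmx0 subr0.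
by rewrite -[LHS]tr_gram rr tr_gram.
Qed.

End Gram.

(** * Orthogonal projections on a span *)

Section Projection.
Variables (R : realType) (d : measure_display) (Y : measurableType d).
Variables (mu : {measure set Y -> \bar R}) (k k' : nat).
Variables (m : 'cV[R]_(k + k') -> Y -> R) (t : 'cV[R]_(k + k')).
Hypotheses (mt_meas : measurable_fun setT (m t)) (mt_ge0 : forall y, 0 <= m t y).
Local Notation gram := (gram mu (m t)).
Local Notation L2 := (square_integrable_vec mu (m t)).

Lemma Emx_gram p q (f : Y -> 'cV[R]_p) (g : Y -> 'cV[R]_q) :
  Emx mu m t (fun y => f y *m (g y)^T) = gram f g.
Proof.
apply/matrixP => i j; rewrite !mxE; apply: eq_Rintegral => y _.
by rewrite mxE big_ord1 mxE.
Qed.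

Lemma gram_inner p q (f : Y -> 'cV[R]_p) (g : Y -> 'cV[R]_q) i j :
  gram f g i j = inner mu m t (component f i) (component g j).
Proof. by rewrite mxE. Qed.

Lemma lin_spanP p (u : Y -> 'cV[R]_p) v :
  lin_span u v <-> exists c : 'rV[R]_p, v = component (fun y => c *m u y) 0.
Proof.
split=> [[c ->]|[c ->]].
  by exists (\row_i c i); apply/funext => y; rewrite /component mxE;
     apply: eq_bigr => i _; rewrite mxE.
by exists (c 0); apply/funext => y; rewrite /component mxE.
Qed.

(** True even without knowing that a projection exists, because the default
    value [0] lies in the span. *)
Lemma oproj_lin p q (u : Y -> 'cV[R]_p) (f : Y -> 'cV[R]_q) :
  exists M : 'M[R]_(q, p), oproj mu m t u f = fun y => M *m u y.
Proof.
have span0 : lin_span u (cst 0).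
  by apply/lin_spanP; exists 0; apply/funext => y; rewrite /component mul0mx mxE.
have /choice [c cE] (a : 'I_q) : exists c : 'rV[R]_p,
    oproj1 mu m t u (component f a) = component (fun y => c *m u y) 0.
  apply/lin_spanP; rewrite /oproj1.
  by case: xgetP => [h _ []|_].
exists (\matrix_a c a); apply/funext => y; apply/matrixP => a b.
by rewrite ord1 mxE cE /component [RHS]mxE mxE; apply: eq_bigr => i _; rewrite mxE.
Qed.

(** When the components of [g] are linearly independent in L2, the normal
    equations [E(f g^T) = M E(g g^T)] have exactly one solution [M], which
    gives both the existence and the uniqueness of the projection. *)
Lemma oprojE p q (g : Y -> 'cV[R]_p) (f : Y -> 'cV[R]_q) :
  L2 g -> L2 f -> gram g g \in unitmx ->
  oproj mu m t g f = fun y => (gram f g *m invmx (gram g g)) *m g y.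
Proof.
move=> gs fs gu; have [M ME] := oproj_lin g f.
suff -> : gram f g *m invmx (gram g g) = M by [].
have normal (N : 'M[R]_(q, p)) : L2 (fun y => f y - N *m g y).
  by apply: square_integrableB => //; exact: square_integrable_mul.
pose N := gram f g *m invmx (gram g g).
have orthN : gram (fun y => f y - N *m g y) g = 0.
  rewrite gramBl// ?gram_mull//; last exact: square_integrable_mul.
  by rewrite mulmxKV// subrr.
suff orthM : gram (fun y => f y - M *m g y) g = 0.
  move: orthM; rewrite gramBl// ?gram_mull//; last exact: square_integrable_mul.
  by move=> /subr0_eq ->; rewrite mulmxK.
apply/matrixP => a b; rewrite gram_inner mxE.
have : [set h : Y -> R | lin_span g h /\
    forall v, lin_span g v -> inner mu m t (fun y => component f a y - h y) v = 0]
    (oproj1 mu m t g (component f a)).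
  rewrite /oproj1; apply: (@xgetI _ _ _ (component (fun y => row a N *m g y) 0)).
  split; first by apply/lin_spanP; exists (row a N).
  move=> v /lin_spanP [c ->].
  have := gram_mulr mt_meas mt_ge0 c (normal N) gs; rewrite orthN mul0mx => /matrixP /(_ a 0).
  rewrite gram_inner mxE => <-; apply: eq_Rintegral => y _; congr (_ * _ * _).
  by rewrite /component -row_mul !mxE.
move=> [_ /(_ (component g b))]; rewrite /inner => <-.
  apply: eq_Rintegral => y _; congr (_ * _ * _).
  move: (congr1 (fun F : Y -> 'cV[R]_q => F y a 0) ME).
  by rewrite /oproj /component !mxE => ->.
apply/lin_spanP; exists (delta_mx 0 b); apply/funext => y.
by rewrite /component -rowE mxE.
Qed.

End Projection.

(** * The information utilized by an estimator *)

Lemma standardized_quadratic (F : fieldType) n (S C W X : 'M[F]_n) :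
  S^T = S -> S \in unitmx -> W^T = W -> W *m W = X ->
  C *m X *m C^T =
  S *m (invmx S *m C *m W) *m (invmx S *m C *m W)^T *m S.
Proof.
move=> Ssym Su Wsym <-; rewrite !trmx_mul trmx_inv Ssym Wsym.
by rewrite !mulmxA mulmxV// mul1mx mulmxKV.
Qed.

Section Information.
Variables (R : realType) (d : measure_display) (Y : measurableType d).
Variables (mu : {measure set Y -> \bar R}) (k k' : nat) (k_gt0 : (0 < k)%N).
Variables (Theta : set 'cV[R]_(k + k')) (m : 'cV[R]_(k + k') -> Y -> R).
Hypothesis reg : regular_family mu Theta m.
Local Notation param := 'cV[R]_(k + k').
Local Notation estimator := (generalized_estimator mu Theta m).
Local Notation L2 t := (square_integrable_vec mu (m t)).
Local Notation s := (orth_score mu m).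
Local Notation gram t := (gram mu (m t)).
Implicit Types (g : Y -> param -> 'cV[R]_k) (t : param).

Let mt_meas t : Theta t -> measurable_fun setT (m t).
Proof. exact: dens_measurable reg t. Qed.

Let mt_ge0 t : Theta t -> forall y, 0 <= m t y.
Proof. by move=> Tt y; exact/ltW/(dens_gt0 reg Tt). Qed.

Lemma variance_gram g t : Vmx mu m g t = gram t (g ^~ t) (g ^~ t).
Proof. exact: Emx_gram. Qed.

Let HM_L2 t p (f : Y -> 'cV[R]_p) : Theta t ->
  (forall a, HM mu Theta m (component f a)) -> L2 t f.
Proof. by move=> Tt fH a; have [fm fi] := fH a; split => //; exact: fi. Qed.

Let score_L2 t : Theta t -> L2 t ((@score R d Y k k' m) ^~ t).
Proof. by move=> Tt; apply: HM_L2 => //; exact: score_HM reg t Tt. Qed.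

Let nuis_score_L2 t : Theta t -> L2 t ((@nuis_score R d Y k k' m) ^~ t).
Proof. by move=> Tt; apply: HM_L2 => //; exact: nuis_score_HM reg t Tt. Qed.

Let estimator_L2 g t : estimator g -> Theta t -> L2 t (g ^~ t).
Proof.
by move=> [_ gH _] Tt; apply: HM_L2 => // a; have [] := gH t Tt a.
Qed.

Let variance_posdefmx g t : estimator g -> Theta t -> posdefmx (Vmx mu m g t).
Proof. by move=> [_ _ [gV _]] Tt; exact: gV. Qed.

Lemma gram_nuis_score g t : estimator g -> Theta t ->
  gram t (g ^~ t) ((@nuis_score R d Y k k' m) ^~ t) = 0.
Proof.
move=> [_ gH _] Tt; apply/matrixP => a b; rewrite gram_inner mxE.
have [_ _] := gH t Tt a; apply; apply/lin_spanP; exists (delta_mx 0 b).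
by apply/funext => y; rewrite /component -rowE [RHS]mxE.
Qed.

(** The two scores differ by a combination of the nuisance scores, to which
    [g] is orthogonal. *)
Lemma gram_score g t : estimator g -> Theta t ->
  gram t (s ^~ t) (g ^~ t) = gram t ((@score R d Y k k' m) ^~ t) (g ^~ t).
Proof.
move=> gE Tt; have gs := estimator_L2 gE Tt.
have mm := mt_meas Tt; have m0 := mt_ge0 Tt.
have [M ME] := oproj_lin mu m t ((@nuis_score R d Y k k' m) ^~ t)
  ((@score R d Y k k' m) ^~ t).
have -> : s ^~ t = fun y => score m y t - M *m nuis_score m y t.
  by apply/funext => y; rewrite /orth_score /orthogonalize ME (score_E0 reg Tt) subr0.
rewrite gramBl//; last 2 first.
- exact: score_L2.
- by apply: square_integrable_mul => //; exact: nuis_score_L2.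
rewrite gram_mull//; last exact: nuis_score_L2.
by rewrite -[gram t (nuis_score m ^~ t) _]tr_gram gram_nuis_score// trmx0 mulmx0 subr0.
Qed.

Section Standardized.
Variables (g : Y -> param -> 'cV[R]_k) (gE : estimator g).
Local Notation V := (Vmx mu m g).
Local Notation W := (fun t => invmx (sqrtmx (V t))).

Let sqrtV t : Theta t -> posdefmx (sqrtmx (V t)) /\ sqrtmx (V t) *m sqrtmx (V t) = V t.
Proof. by move=> Tt; exact: sqrtmxP k_gt0 (variance_posdefmx gE Tt). Qed.

Lemma tr_invsqrt t : Theta t -> (W t)^T = W t.
Proof. by move=> Tt; rewrite trmx_inv (sqrtV Tt).1.1. Qed.

Lemma invsqrt_sqr t : Theta t -> W t *m W t = invmx (V t).
Proof.
move=> Tt; have [Spd SS] := sqrtV Tt; have Su := posdefmx_unit Spd.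
have Vu := posdefmx_unit (variance_posdefmx gE Tt).
apply: (row_free_inj (_ : row_free (V t))); first by rewrite row_free_unit.
by rewrite mulVmx// -{3}SS -mulmxA mulKmx// mulVmx.
Qed.

Lemma standardize_HM t : Theta t ->
  forall a, HM mu Theta m (component (standardize mu m g ^~ t) a).
Proof.
move=> Tt a; have gH b : HM mu Theta m (component (g ^~ t) b).
  by case: gE => _ gH _; have [] := gH t Tt b.
have gL t' : Theta t' -> L2 t' (standardize mu m g ^~ t).
  by move=> Tt'; apply: square_integrable_mul => //;
    [exact: mt_meas|exact: mt_ge0|exact: HM_L2].
split; first by have [] := gL t Tt a.
by move=> t' Tt'; have [] := gL t' Tt' a.
Qed.

Lemma variance_standardize t : Theta t -> Vmx mu m (standardize mu m g) t = 1%:M.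
Proof.
move=> Tt; have mm := mt_meas Tt; have m0 := mt_ge0 Tt.
have gs := estimator_L2 gE Tt; have [Spd SS] := sqrtV Tt.
have Su := posdefmx_unit Spd.
rewrite /Vmx Emx_gram gram_mull//; last exact: square_integrable_mul.
rewrite gram_mulr// -Emx_gram -/(Vmx mu m g t) tr_invsqrt// -{2}SS.
by rewrite mulmxA mulKmx// mulmxV.
Qed.

Lemma standardize_regular : regular_variance mu Theta m (standardize mu m g).
Proof.
split=> [t Tt|].
  rewrite variance_standardize//; split=> [|x x0]; first exact: trmx1.
  by rewrite mulmx1 lt_neqAle eq_sym dot_eq0 x0 dot_ge0.
apply: (C1_ext (param_open reg) _ (C1_cst (param_open reg) (1%:M : 'M[R]_k))).
by move=> t Tt; rewrite variance_standardize.
Qed.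

Lemma standardize_smooth : smooth_in_param mu Theta (standardize mu m g).
Proof.
have Topen := param_open reg.
have WC : C1 Theta W.
  apply: C1_invmx => // [t Tt|]; first exact/posdefmx_unit/(sqrtV Tt).1.
  apply: C1_sqrtmx => // [|t Tt]; last exact: variance_posdefmx.
  by case: gE => _ _ [].
case: gE => gC _ _; apply: filterS gC => y gC; exact: C1_mulmx.
Qed.

(** A mean is a Gram matrix with the constant function [1], which is square
    integrable because the density has total mass one. *)
Lemma mean_standardize t : Theta t -> Emx mu m t (standardize mu m g ^~ t) = 0.
Proof.
move=> Tt; have mm := mt_meas Tt; have m0 := mt_ge0 Tt.
have one : L2 t (fun=> (1%:M : 'M[R]_1)).
  move=> a; split; first exact: measurable_cst.
  rewrite (_ : (fun y => _) = fun y => (m t y)%:E).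
    by rewrite (dens_total reg Tt) ltry.
  by apply/funext => y; rewrite /component ord1 mxE eqxx expr1n mul1r.
have E1 (f : Y -> 'cV[R]_k) : Emx mu m t f = gram t f (fun=> (1%:M : 'M[R]_1)).
  apply/matrixP => a b; rewrite !mxE; apply: eq_Rintegral => y _.
  by rewrite !ord1 eqxx mulr1.
rewrite E1 gram_mull//; last exact: estimator_L2.
rewrite -E1 (_ : Emx _ _ _ _ = 0) ?mulmx0//; apply/matrixP => a b.
by rewrite !mxE ord1; case: gE => _ /(_ t Tt a) [].
Qed.

(** The mean of the standardized estimator vanishes on the open set [Theta],
    and so does its gradient; differentiating under the integral, the
    expected gradient is the opposite of the covariance with the score. *)
Lemma mean_grad_standardize t : Theta t ->
  Emx mu m t (fun y => grad (@lshift k k') (standardize mu m g y) t) =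
  - (gram t ((@score R d Y k k' m) ^~ t) (g ^~ t) *m W t).
Proof.
move=> Tt; have mm := mt_meas Tt; have m0 := mt_ge0 Tt.
have [_ _ _ _] := diff_under_E_theta reg standardize_smooth standardize_regular
  standardize_HM Tt.
rewrite (_ : grad _ _ t = 0); last first.
  apply/matrixP => a b; rewrite !mxE.
  rewrite (@near_eq_derive _ _ _ _ (cst 0)) ?derive_cst//.
  apply: filterS (open_nbhs_nbhs (conj (param_open reg) Tt)) => t' Tt'.
  by rewrite mean_standardize// mxE.
rewrite -/(@score R d Y k k' m) => /esym/eqP; rewrite addr_eq0 => /eqP ->; congr (- _).
rewrite (Emx_gram _ _ _ (@score R d Y k k' m ^~ t) (standardize mu m g ^~ t)).
rewrite gram_mulr//; first by rewrite tr_invsqrt.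
- exact: score_L2.
- exact: estimator_L2.
Qed.

Lemma info_gram t : Theta t ->
  info mu m g t = gram t (s ^~ t) (g ^~ t) *m invmx (V t) *m (gram t (s ^~ t) (g ^~ t))^T.
Proof.
move=> Tt; rewrite /info mean_grad_standardize// linearN /= mulNmx mulmxN opprK.
by rewrite trmx_mul tr_invsqrt// !mulmxA -[_ *m W t *m W t]mulmxA invsqrt_sqr// gram_score.
Qed.

Lemma variance_proj_on t (f : Y -> param -> 'cV[R]_k) : Theta t -> L2 t (f ^~ t) ->
  Vmx mu m (proj_on mu m g f) t =
  gram t (f ^~ t) (g ^~ t) *m invmx (V t) *m (gram t (f ^~ t) (g ^~ t))^T.
Proof.
move=> Tt fs; have mm := mt_meas Tt; have m0 := mt_ge0 Tt.
have gs := estimator_L2 gE Tt.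
have VE := variance_gram g t.
have Vu := posdefmx_unit (variance_posdefmx gE Tt).
have Vsym := (variance_posdefmx gE Tt).1.
rewrite /Vmx /proj_on oprojE// -?VE// Emx_gram gram_mull//; last first.
  exact: square_integrable_mul.
rewrite gram_mulr// -VE [LHS]mulmxA mulmxKV// trmx_mul trmx_inv Vsym.
by rewrite mulmxA.
Qed.

Lemma corr_gram t : Theta t ->
  corr mu m g t =
  invmx (sqrtmx (orth_info mu m t)) *m gram t (s ^~ t) (g ^~ t) *m W t.
Proof.
move=> Tt; have mm := mt_meas Tt; have m0 := mt_ge0 Tt.
have gs := estimator_L2 gE Tt; have ss := estimator_L2 (orth_score_estimator reg) Tt.
rewrite /corr (Emx_gram _ _ _ (standardize mu m s ^~ t) (standardize mu m g ^~ t)).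
rewrite gram_mull//; last exact: square_integrable_mul.
by rewrite gram_mulr// tr_invsqrt// mulmxA.
Qed.

Lemma info_le_orth_info t : Theta t -> lemx (info mu m g t) (orth_info mu m t).
Proof.
move=> Tt; have mm := mt_meas Tt; have m0 := mt_ge0 Tt.
have gs := estimator_L2 gE Tt; have ss := estimator_L2 (orth_score_estimator reg) Tt.
have := posdefmx_unit (variance_posdefmx gE Tt).
rewrite /lemx info_gram// /orth_info (variance_gram s) (variance_gram g).
exact: gram_schur_psdmx.
Qed.

Lemma info_corr t : Theta t ->
  info mu m g t = sqrtmx (orth_info mu m t) *m corr mu m g t *m (corr mu m g t)^T
                  *m sqrtmx (orth_info mu m t).
Proof.
move=> Tt; have Ipd : posdefmx (orth_info mu m t).
  exact: variance_posdefmx (orth_score_estimator reg) Tt.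
have [/posdefmx_unit Su _] := sqrtmxP k_gt0 Ipd.
have [Ssym _] := (sqrtmxP k_gt0 Ipd).1.
rewrite (info_gram Tt) (corr_gram Tt).
exact: standardized_quadratic Ssym Su (tr_invsqrt Tt) (invsqrt_sqr Tt).
Qed.

Lemma info_proj_orth_score t : Theta t ->
  info mu m g t = Vmx mu m (proj_on mu m g s) t.
Proof.
move=> Tt; rewrite info_gram// variance_proj_on//.
exact: estimator_L2 (orth_score_estimator reg) Tt.
Qed.

Lemma info_proj_score t : Theta t ->
  info mu m g t = Vmx mu m (proj_on mu m g (@score R d Y k k' m)) t.
Proof.
by move=> Tt; rewrite info_gram// variance_proj_on ?gram_score//; exact: score_L2.
Qed.

End Standardized.

Lemma info_orth_score t : Theta t -> info mu m s t = orth_info mu m t.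
Proof.
move=> Tt; have sE := orth_score_estimator reg.
have Vu := posdefmx_unit (variance_posdefmx sE Tt).
by rewrite info_gram// -variance_gram mulmxV// mul1mx (variance_posdefmx sE Tt).1.
Qed.

End Information.

Theorem theorem2 (R : realType) (d : measure_display) (Y : measurableType d)
    (mu : {measure set Y -> \bar R}) (k k' : nat) (k_gt0 : (0 < k)%N)
    (Theta : set 'cV[R]_(k + k')) (m : 'cV[R]_(k + k') -> Y -> R)
    (reg : regular_family mu Theta m) :
  let s : Y -> 'cV[R]_(k + k') -> 'cV[R]_k := orth_score mu m in
  let Iperp := orth_info mu m in
  [/\ forall g, generalized_estimator mu Theta m g ->
        forall t, Theta t -> lemx (info mu m g t) (Iperp t),
      forall t, Theta t -> info mu m s t = Iperp t &
      forall g, generalized_estimator mu Theta m g ->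
        forall t, Theta t ->
        [/\ info mu m g t = Vmx mu m (proj_on mu m g s) t,
            info mu m g t = Vmx mu m (proj_on mu m g (@score R d Y k k' m)) t &
            info mu m g t =
              sqrtmx (Iperp t) *m corr mu m g t *m (corr mu m g t)^T
              *m sqrtmx (Iperp t)]].
Proof.
move=> s Iperp; split=> [g gE t Tt|t Tt|g gE t Tt].
- exact (info_le_orth_info k_gt0 reg gE Tt).
- exact (info_orth_score k_gt0 reg Tt).
- split.
  + exact (info_proj_orth_score k_gt0 reg gE Tt).
  + exact (info_proj_score k_gt0 reg gE Tt).
  + exact (info_corr k_gt0 reg gE Tt).
Qed.
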